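(* Let $n\in\mathbb N$ with $n\ge3$. Then $U_{2n}\equiv6\pmod{16}$ and $$U_{2n}\equiv48n-42\pmod{128}\ \text{ if } 2\mid n,\qquad U_{2n}\equiv-16n-42\pmod{128}\ \text{ if } 2\nmid n.$$
   Context: $\mathbb N$ is the set of positive integers; $[x]$ is the greatest integer not exceeding $x$. The sequence $\{U_n\}_{n\ge0}$ is defined by $U_0=1$ and $U_n=-2\sum_{k=1}^{[n/2]}\binom n{2k}U_{n-2k}$ for $n\ge1$. *)

(* Defs.v *)
From HB Require Import structures.
From mathcomp Require Import all_boot all_order all_algebra.

Set Implicit Arguments.
Unset Strict Implicit.
Unset Printing Implicit Defensive.

Import Order.TTheory GRing.Theory Num.Theory.
Local Open Scope ring_scope.

(* The list [:: U_0; ...; U_n]: course-of-values recursion, so that U_n may   *)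
(* refer to all earlier terms. The recurrence itself is lemma [U_rec] below.  *)
Fixpoint U_upto (n : nat) : seq int :=
  if n is m.+1 then
    let s := U_upto m in
    rcons s (- 2 * \sum_(1 <= k < (n./2).+1) 'C(n, 2 * k)%:Z * s`_(n - 2 * k))
  else [:: 1].

Definition U (n : nat) : int := (U_upto n)`_n.

Lemma size_U_upto n : size (U_upto n) = n.+1.
Proof. by elim: n => //= n IHn; rewrite size_rcons IHn. Qed.

Lemma nth_U_upto n i : (i <= n)%N -> (U_upto n)`_i = U i.
Proof.
elim: n => [|n IHn]; first by rewrite leqn0 => /eqP->.
rewrite leq_eqVlt => /predU1P[-> //|]; rewrite ltnS => le_in.
by rewrite /= nth_rcons size_U_upto ltnS le_in IHn.
Qed.

Lemma U_0 : U 0 = 1.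
Proof. by []. Qed.

Lemma U_rec n : (1 <= n)%N ->
  U n = - 2 * \sum_(1 <= k < (n./2).+1) 'C(n, 2 * k)%:Z * U (n - 2 * k).
Proof.
case: n => // n _; rewrite {1}/U [U_upto _]/= nth_rcons size_U_upto ltnn eqxx.
congr (_ * _); apply: eq_big_nat => k /andP[k_gt0 _].
by rewrite nth_U_upto // leq_subLR mul2n -addnn; case: k k_gt0 => // k _;
  rewrite !addSn ltnS leq_addl.
Qed.

(* Main.v *)
Require Import Defs.
From mathcomp Require Import all_boot all_order all_algebra.
From mathcomp Require Import zify ring.
Import Order.TTheory GRing.Theory Num.Theory.
Local Open Scope ring_scope.

(** Since 64 n vanishes modulo 128 for even n, both cases say
    U_{2n} = -16 n - 42 (mod 128). By strong induction, replace U_{2k} in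
    U_{2n} = -2 sum_{k<n} C(2n,2k) U_{2k} by -16 k - 42, with corrections 43, 56
    and 96 at k = 0, 1, 2. The full sums over k <= n of C(2n,2k) and
    k C(2n,2k) are 2^{2n-1} and n 2^{2n-2}, so they drop out modulo 64, leaving
    U_{2n} = -2 (16 n + 42 + 43 + 56 C(2n,2) + 96 C(2n,4)) (mod 128). *)

(** By Pascal's rule each entry of row [m.+1] is the sum of two neighbours in row [m]; taking every
    second entry uses each neighbour once. *)
Lemma sum_bin_even m n :
  (\sum_(0 <= k < n.+1) 'C(m.+1, 2 * k) = \sum_(0 <= i < (2 * n).+1) 'C(m, i))%N.
Proof.
elim: n => [|n IHn]; first by rewrite !big_nat1 !bin0.
rewrite big_nat_recr //= IHn mulnS !addSn add0n.
by rewrite [RHS]big_nat_recr //= [X in _ = (X + _)%N]big_nat_recr //= binS; lia.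
Qed.

Lemma sum_bin_odd m n :
  (\sum_(0 <= k < n) 'C(m.+1, (2 * k).+1) = \sum_(0 <= i < 2 * n) 'C(m, i))%N.
Proof.
elim: n => [|n IHn]; first by rewrite !big_geq.
rewrite big_nat_recr //= IHn mulnS !addSn add0n.
by rewrite [RHS]big_nat_recr //= [X in _ = (X + _)%N]big_nat_recr //= binS; lia.
Qed.

Lemma sum_bin m : (\sum_(0 <= i < m.+1) 'C(m, i) = 2 ^ m)%N.
Proof.
rewrite -[2%N]/(1 + 1)%N expnDn big_mkord; apply: eq_bigr => i _.
by rewrite !exp1n !muln1.
Qed.

Lemma sum_bin_double_even n :
  (\sum_(0 <= k < n.+2) 'C(2 * n.+1, 2 * k) = 2 ^ (2 * n).+1)%N.
Proof.
rewrite mulnS !addSn add0n sum_bin_even mulnS !addSn add0n.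
by rewrite big_nat_recr //= sum_bin bin_small // addn0.
Qed.

(** Absorption, $k\binom{2N}{2k}=N\binom{2N-1}{2k-1}$ with $N=n+1$, reduces this to
    [sum_bin_odd]. *)
Lemma sum_mul_bin_double_even n :
  (\sum_(0 <= k < n.+2) k * 'C(2 * n.+1, 2 * k) = n.+1 * 2 ^ (2 * n))%N.
Proof.
rewrite big_nat_recl // mul0n add0n.
rewrite (eq_bigr (fun k => n.+1 * 'C((2 * n).+1, (2 * k).+1))%N); last first.
  move=> k _; have := mul_bin_diag (2 * n).+2 (2 * k).+1.
  by rewrite !mulnS !addSn !add0n /=; nia.
rewrite -big_distrr /= sum_bin_odd mulnS !addSn add0n.
by rewrite big_nat_recr //= sum_bin bin_small // addn0.
Qed.

Lemma bin_double_2 n : 'C(2 * n, 2)%:Z = n%:Z * (2 * n%:Z - 1).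
Proof.
by rewrite bin2 mul2n -doubleMl doubleK; case: n => // n; lia.
Qed.

Lemma bin_double_4 n : exists t : int, 2 * 'C(2 * n, 4)%:Z = n%:Z ^+ 2 - n%:Z + 4 * t.
Proof.
elim: n => [|n [t IHn]]; first by exists 0.
exists (t + 'C(2 * n, 3)%:Z + n%:Z ^+ 2 - n%:Z).
have := bin_double_2 n.
by rewrite mulnS !addSn add0n !binS; lia.
Qed.

Lemma U_double_rec n : (0 < n)%N ->
  U (2 * n) = - 2 * \sum_(0 <= k < n) 'C(2 * n, 2 * k)%:Z * U (2 * k).
Proof.
move=> n_gt0; rewrite U_rec ?muln_gt0 // {1}mul2n doubleK big_add1 big_nat_rev /=.
congr (_ * _); apply: eq_big_nat => k /andP[_ ltkn].
have -> : (2 * (0 + n - k.+1).+1 = 2 * n - 2 * k)%N by lia.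
(* After reversal of the sum, the symmetry $\binom{2n}{2n-2k}=\binom{2n}{2k}$ concludes. *)
by rewrite bin_sub ?subKn // leq_mul2l ltnW.
Qed.

(** The list makes the value exactly $U_{2k}=1,-2,22$ for $k=0,1,2$; from $k=3$ on, its default
    entry 0 leaves the linear formula. *)
Definition U_residue (k : nat) : int :=
  - 16 * k%:Z - 42 + [:: 43; 56; 96]`_k.

Lemma sum_bin_residue n :
  exists t : int, \sum_(0 <= k < n.+3) 'C(2 * n.+3, 2 * k)%:Z * U_residue k
    = 16 * n.+3%:Z + 85 + 56 * 'C(2 * n.+3, 2)%:Z + 96 * 'C(2 * n.+3, 4)%:Z + 64 * t.
Proof.
set N := n.+3; pose C k := 'C(2 * N, 2 * k)%:Z.
have main : \sum_(0 <= k < N.+1) C k * (- 16 * k%:Z - 42)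
    = - 16 * (N * 2 ^ (2 * n.+2))%:Z - 42 * (2 ^ (2 * n.+2).+1)%:Z.
  rewrite -sum_mul_bin_double_even -sum_bin_double_even.
  rewrite !(big_morph Posz PoszD (erefl _)) !big_distrr /= -sumrB.
  by apply: eq_bigr => k _; rewrite /C PoszM; ring.
have corr : \sum_(0 <= k < N) C k * [:: 43; 56; 96]`_k
    = 43 + 56 * 'C(2 * N, 2)%:Z + 96 * 'C(2 * N, 4)%:Z.
  rewrite 3?big_nat_recl // big1_seq => [|i _]; last by rewrite nth_default ?mulr0.
  by rewrite /C /= bin0; ring.
move: main; rewrite big_nat_recr //= /C binn => main.
rewrite /U_residue (eq_bigr _ (fun k _ => mulrDr _ _ _)) big_split /= corr.
(* This is the full sum in [main] divided by 64; removing its term $k=N$ contributes $16N+42$. *)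
exists (- 4 * (N * 2 ^ (2 * n))%:Z - 21 * (2 ^ (2 * n))%:Z).
by move: main; rewrite !mulnS !addSn !add0n !expnS; lia.
Qed.

Lemma U_double_mod128 n : (128 %| U (2 * n) - U_residue n)%Z.
Proof.
elim/ltn_ind: n => -[|[|[|n]]] IHn.
- by rewrite muln0 U_0.
- by rewrite U_double_rec // big_nat1.
- by rewrite U_double_rec // big_nat_recl // big_nat1 (U_double_rec 1) // big_nat1.
have [t Et] := sum_bin_residue n; set N := n.+3 in IHn Et *.
have /dvdzP[s Es] : (128 %| \sum_(0 <= k < N) 'C(2 * N, 2 * k)%:Z * U (2 * k)
                     - \sum_(0 <= k < N) 'C(2 * N, 2 * k)%:Z * U_residue k)%Z.
  rewrite -sumrB big_mkord; apply: rpred_sum => k _.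
  by rewrite -mulrBr dvdz_mull // IHn.
have [u Eu] := bin_double_4 N; have E2 := bin_double_2 N.
rewrite U_double_rec // [U_residue _]/U_residue nth_default // addr0.
(* With $c=\binom{2N}{4}$, split $-192c=-640c+224\cdot 2c$: by [Eu], the last term cancels the
   $-224N^2$ coming from $-112\binom{2N}{2}$ and adds $896u=128\cdot 7u$. *)
apply/dvdzP; exists (- 2 * s - t + 7 * u - 5 * 'C(2 * N, 4)%:Z - N%:Z - 1).
lia.
Qed.

Theorem corollary4p1 (n : nat) (hn : (3 <= n)%N) :
  (U (2 * n) = 6 %[mod 16])%Z /\
  ((2 %| n)%N -> (U (2 * n) = 48 * n%:Z - 42 %[mod 128])%Z) /\
  (~~ (2 %| n)%N -> (U (2 * n) = - 16 * n%:Z - 42 %[mod 128])%Z).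
Proof.
have := U_double_mod128 n; rewrite /U_residue nth_default // addr0.
by move=> /dvdzP[t Et]; split; [|split]; lia.
Qed.
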